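(* \[ \sum_{n=1}^\infty \bar H_n\left(T_n(2)-\frac1{n}\right)=-\log2+\frac34\zeta(2) \] and \[ \sum_{n=1}^\infty \bar H_n^2\left(T_n(2)-\frac1{n}\right)=\frac58\zeta(3)-\frac32\zeta(2)\log2+\log^22 . \]
   Context: $\bar H_n=\sum_{i=1}^n\frac{(-1)^i}{i}$, $\bar H_n^2=(\bar H_n)^2$, $T_n(2)=\sum_{j=n+1}^\infty\frac1{j^2}$, $\zeta$ is the Riemann zeta function, and $\log^2 2=(\log 2)^2$. *)

(* Defs.v *)
(* Stdlib reals with Coquelicot. *)
From Stdlib Require Import Reals.
From Coquelicot Require Import Coquelicot.
Open Scope R_scope.

(* Coquelicot series start at index 0, so a sum over j >= m is written
   with the summand at m + k, k >= 0. *)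

Definition Hbar (n : nat) : R :=
  sum_n_m (fun i => (-1) ^ i / INR i) 1 n.

Definition T (n p : nat) : R :=
  Series (fun k => 1 / INR (n + 1 + k) ^ p).

(* Riemann zeta function on real arguments s > 1, where its series converges. *)
Definition zeta (s : R) : R :=
  Series (fun k => 1 / Rpower (INR (1 + k)) s).

(* Main.v *)
Require Import Defs.
From Stdlib Require Import Reals Lra Lia.
From Coquelicot Require Import Coquelicot.
Open Scope R_scope.

(** Write h_n for Hbar n, T_n for T n 2 and Z_p for zeta p, and let w_n be
    1 / n^2.

    Both series are reduced to simpler ones by the same summation by parts.
    Since T_(n-1) = T_n + w_n, the weight T_n - 1/n is the difference of
    n T_n at n and n - 1, up to the correction w_n.  Summing by parts against
    a sequence u with u_0 = 0 produces the sum of n T_(n-1) (u_n - u_(n-1)).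
    If n (u_n - u_(n-1)) is itself a difference g_n - g_(n-1), a second
    summation by parts gives
      sum_(i<=n) u_i (T_i - 1/i)
        = ((n + 1) u_n - g_n) T_n - sum_(i<=n) g_i w_i,
    and as (n + 1) T_n tends to 1 the series equals lim u - sum g_i w_i
    ([tail_partial_sum], [tail_series]).  The two choices needed are
      u_n = h_n,    g_n = ((-1)^n - 1) / 2,
      u_n = h_n^2,  g_n = (-1)^n h_n.
    Since h_n tends to - ln 2 ([psum_log2]), and the alternating sums of
    inverse powers come from splitting off even indices ([psum_eta]), the
    first formula follows.  The second one requires the Euler sum
      sum (-1)^n h_n / n^2 = 3/2 Z_2 ln 2 - 5/8 Z_3   ([esum_alternating]).

    This Euler sum comes from the signed Tornheim series
      sum_(m,n>=1) s^m t^n / (m n (m + n)),   s, t = 1 or -1,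
    evaluated in two ways by partial fractions: with 1/(m n) decomposed along
    the diagonals m + n = N, and with 1/(n (m + n)) decomposed for each m.
    Truncating to the triangle m + n <= M makes the equality of the two
    evaluations a finite identity ([esum_triangle]), so that no rearrangement
    of double series is involved; replacing the truncated inner sums by full
    ones costs at most 2 H_M / (M + 1), H_M being the harmonic number
    ([inner_truncation_lim]).  The resulting relation [esum_relation], for
    the signs (-1, -1), (1, -1) and (-1, 1), is a linear system in three
    alternating double sums, solved for the one wanted. *)

(** * Finite sums over 1, ..., n *)

Lemma sum1_0 (f : nat -> R) : sum_n_m f 1 0 = 0.
Proof. now rewrite sum_n_m_zero by lia. Qed.

Lemma sum1_S (f : nat -> R) (n : nat) :
  sum_n_m f 1 (S n) = sum_n_m f 1 n + f (S n).
Proof. now rewrite sum_n_Sm by lia. Qed.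

Lemma sum1_reverse (f : nat -> R) (n : nat) :
  sum_n_m (fun i => f (S n - i)%nat) 1 n = sum_n_m f 1 n.
Proof.
  revert f; induction n as [|n IH]; intros f.
  - now rewrite !sum1_0.
  - rewrite (sum_Sn_m f) by lia.
    rewrite <- (sum_n_m_S f 1 n), <- IH, sum1_S, Rplus_comm.
    replace (S (S n) - S n)%nat with 1%nat by lia.
    apply (f_equal (Rplus (f 1%nat))), sum_n_m_ext_loc.
    intros i Hi; f_equal; lia.
Qed.

Lemma sum1_plus (f g : nat -> R) (n : nat) :
  sum_n_m (fun i => f i + g i) 1 n = sum_n_m f 1 n + sum_n_m g 1 n.
Proof. exact (sum_n_m_plus f g 1 n). Qed.

Lemma sum1_scal (c : R) (f : nat -> R) (n : nat) :
  sum_n_m (fun i => c * f i) 1 n = c * sum_n_m f 1 n.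
Proof. exact (sum_n_m_mult_l (K := R_Ring) c f 1 n). Qed.

Lemma sum1_ext (f g : nat -> R) (n : nat) :
  (forall i, (1 <= i <= n)%nat -> f i = g i) ->
  sum_n_m f 1 n = sum_n_m g 1 n.
Proof. exact (sum_n_m_ext_loc f g 1 n). Qed.

Lemma sum1_le (f g : nat -> R) (n : nat) :
  (forall i, (1 <= i <= n)%nat -> f i <= g i) ->
  sum_n_m f 1 n <= sum_n_m g 1 n.
Proof.
  induction n as [|n IH]; intros H.
  - rewrite !sum1_0; lra.
  - rewrite !sum1_S.
    apply Rplus_le_compat; [apply IH; intros i Hi|]; apply H; lia.
Qed.

Lemma sum1_abs (f : nat -> R) (n : nat) :
  Rabs (sum_n_m f 1 n) <= sum_n_m (fun i => Rabs (f i)) 1 n.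
Proof. exact (norm_sum_n_m (V := R_NormedModule) f 1 n). Qed.

Lemma is_series_sum1 (f : nat -> R) (l : R) :
  is_series (fun k => f (1 + k)%nat) l <-> is_lim_seq (sum_n_m f 1) l.
Proof.
  rewrite is_lim_seq_incr_1.
  split; intros H; (eapply filterlim_ext; [|exact H]); intros n;
    unfold sum_n; simpl.
  - exact (sum_n_m_S f 0 n).
  - symmetry; exact (sum_n_m_S f 0 n).
Qed.

Lemma INR_S_pos (n : nat) : 0 < INR (S n).
Proof. apply lt_0_INR; lia. Qed.

Lemma sign_sqr (s : R) (n : nat) : s * s = 1 -> s ^ n * s ^ n = 1.
Proof. intros H; rewrite <- Rpow_mult_distr, H; apply pow1. Qed.

Lemma sign_abs (s : R) (n : nat) : s * s = 1 -> Rabs (s ^ n) = 1.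
Proof.
  intros H; generalize (sign_sqr s n H); generalize (s ^ n); intros x Hx.
  assert (Hf : (x - 1) * (x + 1) = 0) by lra.
  destruct (Rmult_integral _ _ Hf).
  - replace x with 1 by lra; apply Rabs_R1.
  - replace x with (- (1)) by lra; rewrite Rabs_Ropp; apply Rabs_R1.
Qed.

(** * Power sums and Euler sums *)

Definition psum (s : R) (p n : nat) : R :=
  sum_n_m (fun i => s ^ i / INR i ^ p) 1 n.

(** At s, t = 1 or -1 these are the partial sums of the (alternating) double
    zeta values of weight 3, with the diagonal terms included. *)
Definition esum (s t : R) (n : nat) : R :=
  sum_n_m (fun i => s ^ i / INR i ^ 2 * psum t 1 i) 1 n.

Lemma psum_0 (s : R) (p : nat) : psum s p 0 = 0.
Proof. apply sum1_0. Qed.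

Lemma psum_S (s : R) (p n : nat) :
  psum s p (S n) = psum s p n + s ^ S n / INR (S n) ^ p.
Proof. exact (sum1_S (fun i => s ^ i / INR i ^ p) n). Qed.

Lemma esum_0 (s t : R) : esum s t 0 = 0.
Proof. apply sum1_0. Qed.

Lemma esum_S (s t : R) (n : nat) :
  esum s t (S n) =
  esum s t n + s ^ S n / INR (S n) ^ 2 * psum t 1 (S n).
Proof. exact (sum1_S (fun i => s ^ i / INR i ^ 2 * psum t 1 i) n). Qed.

Lemma Hbar_psum (n : nat) : Hbar n = psum (-1) 1 n.
Proof.
  apply sum_n_m_ext; intros i; now rewrite pow_1.
Qed.

(** * Alternating power sums and log 2 *)

(** Adding the plain and the alternating sum leaves twice the even-indexed
    terms.  At p = 1 this expresses the alternating harmonic sum as minus a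
    block of the harmonic series. *)
Lemma psum_even (p n : nat) :
  psum (-1) p (2 * n) = 2 / 2 ^ p * psum 1 p n - psum 1 p (2 * n).
Proof.
  induction n as [|n IH].
  - simpl Nat.mul; rewrite !psum_0; ring.
  - replace (2 * S n)%nat with (S (S (2 * n))) by lia.
    rewrite !psum_S, IH.
    assert (E : INR (S (S (2 * n))) = 2 * INR (S n)).
    { rewrite !S_INR, mult_INR; simpl; ring. }
    rewrite E, !pow1, Rpow_mult_distr.
    change ((-1) ^ S (2 * n)) with ((-1) * (-1) ^ (2 * n)).
    change ((-1) ^ S (S (2 * n))) with ((-1) * ((-1) * (-1) ^ (2 * n))).
    rewrite pow_1_even.
    field; repeat split; apply pow_nonzero;
      try apply not_0_INR; try lra; lia.
Qed.

(** [psum_even] only controls even indices; vanishing increments carry the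
    limit over to the odd ones. *)
Lemma is_lim_seq_even_odd (u : nat -> R) (l : R) :
  is_lim_seq (fun n => u (2 * n)%nat) l ->
  is_lim_seq (fun n => u (S n) - u n) 0 ->
  is_lim_seq u l.
Proof.
  intros He Hd.
  apply is_lim_seq_spec in He; apply is_lim_seq_spec in Hd.
  apply is_lim_seq_spec; intros eps.
  destruct (He (pos_div_2 eps)) as [N1 H1].
  destruct (Hd (pos_div_2 eps)) as [N2 H2].
  simpl in H1, H2.
  exists (2 * N1 + S N2)%nat; intros n Hn.
  pose proof (cond_pos eps).
  destruct (Nat.Even_or_Odd n) as [[k Hk]|[k Hk]].
  - subst n. specialize (H1 k ltac:(lia)).
    replace (k + (k + 0))%nat with (2 * k)%nat in H1 by lia; lra.
  - specialize (H1 k ltac:(lia)). specialize (H2 (2 * k)%nat ltac:(lia)).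
    replace (k + (k + 0))%nat with (2 * k)%nat in H1 by lia.
    replace n with (S (2 * k)) by lia.
    replace (u (S (2 * k)) - l)
      with ((u (S (2 * k)) - u (2 * k)%nat - 0) + (u (2 * k)%nat - l)) by ring.
    eapply Rle_lt_trans; [apply Rabs_triang|]. lra.
Qed.

Lemma is_lim_seq_inv_S : is_lim_seq (fun n => / INR (S n)) 0.
Proof.
  apply (is_lim_seq_incr_1 (fun n => / INR n)).
  replace (Finite 0) with (Rbar_inv p_infty) by reflexivity.
  apply is_lim_seq_inv; [apply is_lim_seq_INR | discriminate].
Qed.

Lemma is_lim_seq_squeeze0 (u v : nat -> R) :
  (forall n, Rabs (u n) <= v n) -> is_lim_seq v 0 -> is_lim_seq u 0.
Proof.
  intros H Hv; apply is_lim_seq_abs_0.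
  apply (is_lim_seq_le_le (fun _ => 0) _ v); auto using is_lim_seq_const.
  intros n; split; [apply Rabs_pos | apply H].
Qed.

Lemma filterlim_double : filterlim (fun n => (2 * n)%nat) eventually eventually.
Proof. intros P [N HN]; exists N; intros n Hn; apply HN; lia. Qed.

Lemma inv_pow_le (p n : nat) : (1 <= p)%nat -> / INR (S n) ^ p <= / INR (S n).
Proof.
  intros Hp; pose proof (INR_S_pos n).
  apply Rinv_le_contravar; [assumption|].
  rewrite <- (pow_1 (INR (S n))) at 1.
  apply Rle_pow; [rewrite S_INR; pose proof (pos_INR n); lra | assumption].
Qed.

Lemma psum_diff_lim (p : nat) : (1 <= p)%nat ->
  is_lim_seq (fun n => psum (-1) p (S n) - psum (-1) p n) 0.
Proof.
  intros Hp; apply is_lim_seq_squeeze0 with (2 := is_lim_seq_inv_S).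
  intros n; rewrite psum_S.
  replace (psum (-1) p n + (-1) ^ S n / INR (S n) ^ p - psum (-1) p n)
    with ((-1) ^ S n * / INR (S n) ^ p) by (unfold Rdiv; ring).
  rewrite Rabs_mult, sign_abs by lra.
  rewrite Rmult_1_l, Rabs_pos_eq; [now apply inv_pow_le|].
  apply Rlt_le, Rinv_0_lt_compat, pow_lt, INR_S_pos.
Qed.

Lemma psum_eta (p : nat) (l : R) : (1 <= p)%nat ->
  is_lim_seq (psum 1 p) l ->
  is_lim_seq (psum (-1) p) ((2 / 2 ^ p - 1) * l).
Proof.
  intros Hp H; apply is_lim_seq_even_odd; [|now apply psum_diff_lim].
  apply is_lim_seq_ext with
    (fun n => 2 / 2 ^ p * psum 1 p n - psum 1 p (2 * n)).
  - intros n; symmetry; apply psum_even.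
  - replace ((2 / 2 ^ p - 1) * l) with (2 / 2 ^ p * l - l) by ring.
    apply is_lim_seq_minus'.
    + exact (is_lim_seq_scal_l _ _ (Finite l) H).
    + exact (is_lim_seq_subseq _ _ _ filterlim_double H).
Qed.

(** Both bounds are ln x <= x - 1, at (n + 1) / n and at its inverse. *)
Lemma ln_succ_bounds (n : nat) : (1 <= n)%nat ->
  / INR (S n) <= ln (INR (S n)) - ln (INR n) <= / INR n.
Proof.
  intros Hn.
  assert (H0 : 0 < INR n) by (apply lt_0_INR; lia).
  assert (Hl : forall x, 0 < x -> ln x <= x - 1).
  { intros x Hx. pose proof (exp_ineq1_le (ln x)) as E.
    rewrite exp_ln in E by assumption; lra. }
  pose proof (INR_S_pos n) as H1.
  assert (E1 : ln (INR (S n) / INR n) = ln (INR (S n)) - ln (INR n))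
    by (apply ln_div; assumption).
  assert (E2 : ln (INR n / INR (S n)) = ln (INR n) - ln (INR (S n)))
    by (apply ln_div; assumption).
  pose proof (Hl _ (Rdiv_lt_0_compat _ _ H1 H0)) as L1.
  pose proof (Hl _ (Rdiv_lt_0_compat _ _ H0 H1)) as L2.
  assert (F1 : INR (S n) / INR n - 1 = / INR n)
    by (rewrite S_INR; field; lra).
  assert (F2 : INR n / INR (S n) - 1 = - / INR (S n))
    by (rewrite S_INR in *; field; lra).
  lra.
Qed.

(** Comparison of a block of the harmonic series with the integral of 1/x. *)
Lemma harmonic_block (n k : nat) :
  ln (INR (S n + k)) - ln (INR (S n))
    <= psum 1 1 (n + k) - psum 1 1 n /\
  psum 1 1 (S n + k) - psum 1 1 (S n)
    <= ln (INR (S n + k)) - ln (INR (S n)).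
Proof.
  induction k as [|k [IH1 IH2]].
  - rewrite !Nat.add_0_r; lra.
  - rewrite !Nat.add_succ_r, (psum_S 1 1 (n + k)), (psum_S 1 1 (S n + k)).
    rewrite !pow1, !pow_1.
    pose proof (ln_succ_bounds (S n + k) ltac:(lia)) as B.
    change (S (n + k)) with (S n + k)%nat.
    unfold Rdiv; rewrite !Rmult_1_l; lra.
Qed.

Lemma psum_log2 : is_lim_seq (psum (-1) 1) (- ln 2).
Proof.
  apply is_lim_seq_even_odd; [|now apply psum_diff_lim].
  apply is_lim_seq_incr_1.
  apply is_lim_seq_le_le with
    (u := fun n => - ln 2) (w := fun n => - ln 2 + / INR (S n)).
  - intros n; rewrite psum_even, pow_1.
    destruct (harmonic_block n (S n)) as [_ U].
    destruct (harmonic_block (S n) (S n)) as [L _].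
    pose proof (INR_S_pos n) as H0.
    assert (E : INR (S n + S n) = 2 * INR (S n)) by (rewrite plus_INR; ring).
    pose proof (ln_succ_bounds (S n) ltac:(lia)) as B.
    replace (S (S n) + S n)%nat with (S (S n + S n)) in L by lia.
    pose proof (ln_succ_bounds (S n + S n) ltac:(lia)) as B2.
    rewrite E in U, B2; rewrite ln_mult in U, B2 by lra.
    replace (2 * S n)%nat with (S n + S n)%nat by lia.
    replace (2 / 2 * psum 1 1 (S n)) with (psum 1 1 (S n)) by field.
    assert (0 < / INR (S (S n + S n))) by (apply Rinv_0_lt_compat, INR_S_pos).
    lra.
  - apply is_lim_seq_const.
  - replace (- ln 2) with (- ln 2 + 0) at 1 by ring.
    apply is_lim_seq_plus'; [apply is_lim_seq_const | apply is_lim_seq_inv_S].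
Qed.

(** * Convergence of the power sums and of the tails *)

(** 1 / x^2 lies between the telescoping terms 1/x - 1/(x+1) and
    1/(x-1) - 1/x.  The upper bound is shifted by one so as to avoid
    dividing by 0. *)
Lemma inv_sqr_tail_bounds (n k : nat) :
  / INR (S n) - / INR (S (S n + k))
    <= sum_n (fun i => 1 / INR (n + 1 + i) ^ 2) k /\
  sum_n (fun i => 1 / INR (S n + 1 + i) ^ 2) k
    <= / INR (S n) - / INR (S (S n + k)).
Proof.
  assert (B : forall m, (1 <= m)%nat ->
    / INR m - / INR (S m) <= 1 / INR m ^ 2 /\
    1 / INR (S m) ^ 2 <= / INR m - / INR (S m)).
  { intros m Hm. assert (0 < INR m) by (apply lt_0_INR; lia).
    rewrite S_INR; set (x := INR m) in *.
    replace (/ x - / (x + 1)) with (/ (x * (x + 1))) by (field; lra).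
    unfold Rdiv; rewrite !Rmult_1_l.
    split; apply Rinv_le_contravar; nra. }
  induction k as [|k [IH1 IH2]].
  - rewrite !sum_O, !Nat.add_0_r, !Nat.add_1_r; apply B; lia.
  - rewrite !sum_Sn.
    unfold plus; simpl AbelianMonoid.sort in *; simpl.
    pose proof (B (S n + S k)%nat ltac:(lia)) as [B1 B2].
    replace (n + 1 + S k)%nat with (S n + S k)%nat by lia.
    replace (S n + 1 + S k)%nat with (S (S n + S k)) by lia.
    replace (S (n + S k)) with (S n + S k)%nat by lia.
    replace (S (S n + k)) with (S n + S k)%nat in IH1, IH2 by lia.
    simpl in *; lra.
Qed.

Lemma ex_series_inv_sqr (n : nat) :
  ex_series (fun k => 1 / INR (n + 1 + k) ^ 2).
Proof.
  assert (HS : forall m, ex_series (fun k => 1 / INR (S m + 1 + k) ^ 2)).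
  { intros m.
    destruct (ex_finite_lim_seq_incr
      (sum_n (fun k => 1 / INR (S m + 1 + k) ^ 2)) (/ INR (S m))) as [l Hl].
    - intros k; rewrite sum_Sn.
      assert (0 <= 1 / INR (S m + 1 + S k) ^ 2).
      { unfold Rdiv; rewrite Rmult_1_l.
        apply Rlt_le, Rinv_0_lt_compat, pow_lt, INR_S_pos. }
      unfold plus; simpl in *; lra.
    - intros k; destruct (inv_sqr_tail_bounds m k) as [_ U].
      pose proof (Rinv_0_lt_compat _ (INR_S_pos (S m + k))).
      lra.
    - exists l; exact Hl. }
  destruct n as [|n]; [|apply HS].
  apply ex_series_incr_1.
  eapply ex_series_ext; [|apply (HS 0%nat)].
  reflexivity.
Qed.

Lemma T_S (n : nat) : T n 2 = 1 / INR (S n) ^ 2 + T (S n) 2.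
Proof.
  unfold T; rewrite Series_incr_1 by apply ex_series_inv_sqr.
  f_equal.
  - now rewrite Nat.add_0_r, Nat.add_1_r.
  - apply Series_ext; intros k; now rewrite Nat.add_succ_r.
Qed.

Lemma T_lower (n : nat) : / INR (S n) <= T n 2.
Proof.
  assert (H : Rbar_le (/ INR (S n) - 0) (T n 2));
    [|change (/ INR (S n) - 0 <= T n 2) in H; lra].
  eapply is_lim_seq_le.
  - intros k; exact (proj1 (inv_sqr_tail_bounds n k)).
  - apply is_lim_seq_minus'; [apply is_lim_seq_const|].
    apply (is_lim_seq_ext (fun k => / INR (S (k + S n)))).
    + intros k; now rewrite (Nat.add_comm k), Nat.add_succ_l.
    + apply (is_lim_seq_incr_n (fun k => / INR (S k))), is_lim_seq_inv_S.
  - exact (Series_correct _ (ex_series_inv_sqr n)).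
Qed.

Lemma T_upper (n : nat) : T (S n) 2 <= / INR (S n).
Proof.
  assert (H : Rbar_le (T (S n) 2) (/ INR (S n))); [|exact H].
  eapply is_lim_seq_le.
  - intros k; apply Rle_trans with (1 := proj2 (inv_sqr_tail_bounds n k)).
    pose proof (Rinv_0_lt_compat _ (INR_S_pos (S n + k))).
    instantiate (1 := fun _ => / INR (S n)); simpl in *; lra.
  - exact (Series_correct _ (ex_series_inv_sqr (S n))).
  - apply is_lim_seq_const.
Qed.

Lemma T_lim : is_lim_seq (fun n => T n 2) 0.
Proof.
  apply is_lim_seq_incr_1, is_lim_seq_squeeze0 with (2 := is_lim_seq_inv_S).
  intros n; pose proof (T_lower (S n)); pose proof (T_upper n).
  pose proof (Rinv_0_lt_compat _ (INR_S_pos (S n))).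
  rewrite Rabs_pos_eq; lra.
Qed.

(** This limit is what survives of the boundary term of the summation by
    parts. *)
Lemma mul_T_lim : is_lim_seq (fun n => INR (S n) * T n 2) 1.
Proof.
  apply is_lim_seq_incr_1.
  apply is_lim_seq_le_le with
    (u := fun _ => 1) (w := fun n => 1 + / INR (S n)).
  - intros n; pose proof (T_lower (S n)) as L; pose proof (T_upper n) as U.
    pose proof (INR_S_pos (S n)) as P; pose proof (INR_S_pos n) as P0.
    apply (Rmult_le_compat_l _ _ _ (Rlt_le _ _ P)) in L, U.
    rewrite Rinv_r in L by lra.
    replace (INR (S (S n)) * / INR (S n)) with (1 + / INR (S n)) in U
      by (rewrite (S_INR (S n)); field; lra).
    lra.
  - apply is_lim_seq_const.
  - replace 1 with (1 + 0) at 1 by ring.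
    apply is_lim_seq_plus'; [apply is_lim_seq_const | apply is_lim_seq_inv_S].
Qed.

Lemma psum_zeta (p : nat) : (2 <= p)%nat ->
  is_lim_seq (psum 1 p) (zeta (INR p)).
Proof.
  intros Hp.
  apply (is_series_sum1 (fun i => 1 ^ i / INR i ^ p)).
  assert (E : forall k, 1 / Rpower (INR (1 + k)) (INR p)
                        = 1 ^ (1 + k) / INR (1 + k) ^ p).
  { intros k; rewrite Rpower_pow by apply INR_S_pos.
    now rewrite pow1. }
  apply is_series_ext with (1 := E), Series_correct.
  apply (ex_series_le (K := R_AbsRing) (V := R_CompleteNormedModule))
    with (2 := ex_series_inv_sqr 0).
  intros k; rewrite E, pow1; unfold Rdiv; rewrite !Rmult_1_l.
  pose proof (INR_S_pos k) as P.
  change (0 + 1 + k)%nat with (S k); change (1 + k)%nat with (S k).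
  change (Rabs (/ INR (S k) ^ p) <= / INR (S k) ^ 2).
  rewrite Rabs_pos_eq by (apply Rlt_le, Rinv_0_lt_compat, pow_lt, P).
  apply Rinv_le_contravar; [apply pow_lt, P|].
  apply Rle_pow; [|assumption].
  rewrite S_INR; pose proof (pos_INR k); lra.
Qed.

(** * The alternating Euler sum *)

(** Both sides are the signed Tornheim sum of s^m t^n / (m n (m + n)) over
    m, n >= 1 with m + n at most a given bound, called n in the statement.
    The right side sums over the second index for fixed m, where
    1 / (n (m + n)) = (1/n - 1/(m + n)) / m; the left side sums along the
    diagonals m + n = N, where 1 / (m n) = (1/m + 1/n) / N.  The power sums of
    exponent 3 remove the diagonal terms i = N included in [esum].  In the
    induction step only the diagonal N = n + 1 is added. *)
Lemma esum_triangle (s t r : R) (n : nat) :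
  s * s = 1 -> t * t = 1 -> r = s * t ->
  esum t r n + esum s r n - psum s 3 n - psum t 3 n
  = sum_n_m (fun m => s ^ m / INR m ^ 2 *
      (psum t 1 (n - m) - t ^ m * (psum t 1 n - psum t 1 m))) 1 n.
Proof.
  intros Hs Ht Hr.
  induction n as [|n IH].
  - now rewrite sum1_0, !esum_0, !psum_0; ring_simplify.
  - rewrite sum1_S, Nat.sub_diag, psum_0.
    set (N := INR (S n)).
    assert (HN : N <> 0) by (apply not_0_INR; lia).
    assert (HsN := sign_sqr s (S n) Hs).
    assert (HtN := sign_sqr t (S n) Ht).
    assert (HrN : r ^ S n = s ^ S n * t ^ S n)
      by (rewrite Hr; apply Rpow_mult_distr).
    rewrite !esum_S, !(psum_S _ 3), (psum_S r 1); fold N.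
    rewrite (sum1_ext _ (fun m => s ^ m / INR m ^ 2 *
      (psum t 1 (n - m) - t ^ m * (psum t 1 n - psum t 1 m))
      + (t ^ S n / N ^ 2 * (r ^ m / INR m ^ 1)
      + s ^ S n / N ^ 2 * (r ^ (S n - m) / INR (S n - m) ^ 1)))).
    (* The two halves of the new diagonal are exchanged by m -> N - m. *)
    + rewrite sum1_plus, <- IH, sum1_plus, !sum1_scal.
      rewrite (sum1_reverse (fun i => r ^ i / INR i ^ 1)).
      fold (psum r 1 n).
      rewrite HrN, !pow_1.
      replace (t ^ S n / N ^ 2 * (psum r 1 n + s ^ S n * t ^ S n / N))
        with (t ^ S n / N ^ 2 * psum r 1 n
              + s ^ S n * (t ^ S n * t ^ S n) / N ^ 3) by (field; assumption).
      replace (s ^ S n / N ^ 2 * (psum r 1 n + s ^ S n * t ^ S n / N))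
        with (s ^ S n / N ^ 2 * psum r 1 n
              + t ^ S n * (s ^ S n * s ^ S n) / N ^ 3) by (field; assumption).
      rewrite HsN, HtN; field; assumption.
    + intros m Hm.
      (* With N = m + k and the signs a, c of s and b, d of t at m and k, the
         identity is rational once the squares b * b and c * c are 1. *)
      replace (S n - m)%nat with (S (n - m)) by lia.
      rewrite !(psum_S t 1), !pow_1; fold N.
      assert (HM : INR m <> 0) by (apply not_0_INR; lia).
      assert (HK : INR (S (n - m)) <> 0) by (apply not_0_INR; lia).
      assert (EN : N = INR m + INR (S (n - m)))
        by (unfold N; rewrite <- plus_INR; f_equal; lia).
      assert (Htm := sign_sqr t m Ht).
      assert (Hsm := sign_sqr s m Hs).
      assert (Hrm : r ^ m = s ^ m * t ^ m)
        by (rewrite Hr; apply Rpow_mult_distr).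
      assert (EtN : t ^ S n = t ^ m * t ^ S (n - m))
        by (rewrite <- pow_add; f_equal; lia).
      assert (EsN : s ^ S n = s ^ m * s ^ S (n - m))
        by (rewrite <- pow_add; f_equal; lia).
      assert (Erk : r ^ S (n - m) = s ^ S (n - m) * t ^ S (n - m))
        by (rewrite Hr; apply Rpow_mult_distr).
      assert (Hsk := sign_sqr s (S (n - m)) Hs).
      rewrite EtN, EsN, Hrm, Erk.
      clearbody N.
      set (M := INR m) in *; set (K := INR (S (n - m))) in *.
      set (a := s ^ m) in *; set (b := t ^ m) in *.
      set (c := s ^ S (n - m)) in *; set (d := t ^ S (n - m)) in *.
      replace (b * d / N ^ 2 * (a * b / M)) with ((b * b) * (a * d / (N ^ 2 * M)))
        by (field; auto).
      replace (a * c / N ^ 2 * (c * d / K)) with ((c * c) * (a * d / (N ^ 2 * K)))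
        by (field; auto).
      replace (a / M ^ 2 * (psum t 1 (n - m) + d / K
                 - b * (psum t 1 n + b * d / N - psum t 1 m)))
        with (a / M ^ 2 * (psum t 1 (n - m) - b * (psum t 1 n - psum t 1 m))
              + a / M ^ 2 * (d / K - (b * b) * d / N)) by (field; auto).
      rewrite Htm, Hsk; subst N; field; auto.
Qed.

Lemma psum_1_step (t : R) (n k : nat) : t * t = 1 ->
  Rabs (psum t 1 (n + k) - psum t 1 n) <= INR k / INR (S n).
Proof.
  intros Ht; pose proof (INR_S_pos n) as P.
  induction k as [|k IH].
  - rewrite Nat.add_0_r, Rminus_diag, Rabs_R0; simpl; unfold Rdiv; lra.
  - rewrite Nat.add_succ_r, psum_S, pow_1.
    replace (psum t 1 (n + k) + t ^ S (n + k) / INR (S (n + k)) - psum t 1 n)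
      with (psum t 1 (n + k) - psum t 1 n + t ^ S (n + k) * / INR (S (n + k)))
      by (unfold Rdiv; ring).
    eapply Rle_trans; [apply Rabs_triang|].
    rewrite Rabs_mult, sign_abs, Rmult_1_l by assumption.
    rewrite (Rabs_pos_eq (/ _)) by apply Rlt_le, Rinv_0_lt_compat, INR_S_pos.
    replace (INR (S k) / INR (S n)) with (INR k / INR (S n) + / INR (S n))
      by (rewrite (S_INR k); field; lra).
    apply Rplus_le_compat; [assumption|].
    apply Rinv_le_contravar; [assumption | apply le_INR; lia].
Qed.

(** Cesaro means of the null sequence 1/n. *)
Lemma harmonic_mean_lim :
  is_lim_seq (fun n => psum 1 1 n / INR (S n)) 0.
Proof.
  assert (C : is_lim_seq (fun n => psum 1 1 n / INR n) 0).
  { pose proof (Cesaro_1 _ _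
      (proj1 (is_lim_seq_Reals _ 0) is_lim_seq_inv_S)) as H.
    apply is_lim_seq_Reals in H; apply is_lim_seq_incr_1.
    apply is_lim_seq_incr_1 in H; revert H; apply is_lim_seq_ext.
    intros n; unfold Rdiv; f_equal; simpl Init.Nat.pred.
    induction n as [|n IH].
    - simpl; rewrite psum_S, psum_0; simpl; field.
    - rewrite psum_S, <- IH, pow1, pow_1.
      change (sum_f_R0 (fun n => / INR (S n)) (S n))
        with (sum_f_R0 (fun n => / INR (S n)) n + / INR (S (S n))).
      field; apply not_0_INR; lia. }
  apply is_lim_seq_incr_1, is_lim_seq_squeeze0
    with (2 := proj1 (is_lim_seq_incr_1 _ _) C).
  intros n.
  assert (0 <= psum 1 1 (S n)).
  { generalize (S n); intros k; induction k as [|k IH].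
    - rewrite psum_0; lra.
    - rewrite psum_S, pow1, pow_1.
      pose proof (Rdiv_lt_0_compat _ _ Rlt_0_1 (INR_S_pos k)); lra. }
  pose proof (INR_S_pos n); pose proof (INR_S_pos (S n)).
  rewrite Rabs_pos_eq by (apply Rdiv_le_0_compat; assumption).
  apply Rmult_le_compat_l; [assumption|].
  apply Rinv_le_contravar; [assumption | apply le_INR; lia].
Qed.

(** The inner difference is at most m / (n - m + 1) in absolute value by
    [psum_1_step], so the sum is dominated by the convolution of 1/m with
    1/(n + 1 - m), which partial fractions turn into 2 H_n / (n + 1). *)
Lemma inner_truncation_lim (s t : R) : s * s = 1 -> t * t = 1 ->
  is_lim_seq (fun n => sum_n_m (fun m => s ^ m / INR m ^ 2 *
    (psum t 1 (n - m) - psum t 1 n)) 1 n) 0.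
Proof.
  intros Hs Ht.
  apply is_lim_seq_squeeze0 with (v := fun n => 2 * (psum 1 1 n / INR (S n))).
  - intros n; eapply Rle_trans; [apply sum1_abs|].
    assert (E : 2 * (psum 1 1 n / INR (S n)) =
      sum_n_m (fun m => / INR (S n) * (1 ^ m / INR m ^ 1)
         + / INR (S n) * (1 ^ (S n - m) / INR (S n - m) ^ 1)) 1 n).
    { rewrite sum1_plus, !sum1_scal.
      rewrite (sum1_reverse (fun i => 1 ^ i / INR i ^ 1)).
      fold (psum 1 1 n); field; apply not_0_INR; lia. }
    rewrite E; apply sum1_le; intros m Hm.
    rewrite Rabs_mult; unfold Rdiv at 1.
    rewrite Rabs_mult, sign_abs, Rmult_1_l by assumption.
    assert (PM : 0 < INR m) by (apply lt_0_INR; lia).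
    rewrite (Rabs_pos_eq (/ INR m ^ 2))
      by (apply Rlt_le, Rinv_0_lt_compat, pow_lt, PM).
    pose proof (psum_1_step t (n - m) m Ht) as B.
    replace (n - m + m)%nat with n in B by lia.
    rewrite Rabs_minus_sym.
    replace (S n - m)%nat with (S (n - m)) by lia.
    pose proof (INR_S_pos (n - m)) as PK.
    rewrite !pow1, !pow_1.
    assert (EN : INR (S n) = INR m + INR (S (n - m)))
      by (rewrite <- plus_INR; f_equal; lia).
    eapply Rle_trans.
    + apply Rmult_le_compat_l; [|exact B].
      apply Rlt_le, Rinv_0_lt_compat, pow_lt, PM.
    + rewrite EN; right; field; lra.
  - replace (Finite 0) with (Rbar_mult 2 0) by (simpl; f_equal; ring).
    exact (is_lim_seq_scal_l _ 2 (Finite 0) harmonic_mean_lim).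
Qed.

(** The limit form of the two evaluations of the Tornheim series.  The finite
    sum [psum t 1 n] is kept in place of its limit because the latter does not
    exist for t = 1; in that case r = s and its coefficient is 0. *)
Lemma esum_relation (s t r : R) : s * s = 1 -> t * t = 1 -> r = s * t ->
  is_lim_seq (fun n =>
    esum t r n + esum s r n - psum s 3 n - psum t 3 n
    - (esum r t n + (psum s 2 n - psum r 2 n) * psum t 1 n)) 0.
Proof.
  intros Hs Ht Hr.
  apply is_lim_seq_ext with (2 := inner_truncation_lim s t Hs Ht).
  intros n; rewrite esum_triangle with (1 := Hs) (2 := Ht) (3 := Hr).
  symmetry.
  rewrite (sum1_ext _ (fun m =>
    s ^ m / INR m ^ 2 * (psum t 1 (n - m) - psum t 1 n)
    + (psum t 1 n * (s ^ m / INR m ^ 2)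
       + (- psum t 1 n * (r ^ m / INR m ^ 2)
          + r ^ m / INR m ^ 2 * psum t 1 m)))).
  - rewrite !sum1_plus, !sum1_scal.
    fold (psum s 2 n) (psum r 2 n) (esum r t n); ring.
  - intros m _; rewrite Hr, Rpow_mult_distr; unfold Rdiv; ring.
Qed.

Lemma esum_alternating :
  is_lim_seq (esum (-1) (-1)) (3 / 2 * zeta 2 * ln 2 - 5 / 8 * zeta 3).
Proof.
  pose proof (psum_zeta 2 ltac:(lia)) as Z2.
  pose proof (psum_zeta 3 ltac:(lia)) as Z3.
  replace (INR 2) with 2 in Z2 by (simpl; ring).
  replace (INR 3) with 3 in Z3 by (simpl; ring).
  pose proof (psum_eta 2 _ ltac:(lia) Z2) as E2.
  pose proof (psum_eta 3 _ ltac:(lia) Z3) as E3.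
  pose proof psum_log2 as L.
  pose proof (esum_relation (-1) (-1) 1 ltac:(lra) ltac:(lra) ltac:(lra)) as A.
  pose proof (esum_relation 1 (-1) (-1) ltac:(lra) ltac:(lra) ltac:(lra)) as B.
  pose proof (esum_relation (-1) 1 (-1) ltac:(lra) ltac:(lra) ltac:(lra)) as C.
  (* C + (A - B) / 2 eliminates the other two double sums and expresses
     esum (-1) (-1) by power sums alone; V is the limit of that expression. *)
  pose proof (is_lim_seq_plus' _ _ _ _ C
    (is_lim_seq_scal_l _ (1 / 2) (Finite _) (is_lim_seq_minus' _ _ _ _ A B)))
    as K.
  pose proof (is_lim_seq_minus' _ _ _ _
    (is_lim_seq_plus' _ _ _ _
      (is_lim_seq_scal_l _ (1 / 2) (Finite _) Z3)
      (is_lim_seq_scal_l _ (3 / 2) (Finite _) E3))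
    (is_lim_seq_mult' _ _ _ _ (is_lim_seq_minus' _ _ _ _ Z2 E2) L)) as V.
  pose proof (is_lim_seq_plus' _ _ _ _ K V) as W.
  match type of W with is_lim_seq ?u (Finite ?l) =>
    apply (is_lim_seq_ext u);
    [| replace (3 / 2 * zeta 2 * ln 2 - 5 / 8 * zeta 3) with l; [exact W|]]
  end.
  - intros n; field.
  - field.
Qed.

(** * Summation by parts against the tails *)

(** The double summation by parts, checked by telescoping: the increment of
    the boundary term uses T n 2 = T (n + 1) 2 + 1 / (n + 1)^2. *)
Lemma tail_partial_sum (u g : nat -> R) (n : nat) :
  u 0%nat = 0 -> g 0%nat = 0 ->
  (forall k, INR (S k) * (u (S k) - u k) = g (S k) - g k) ->
  (INR (S n) * u n - g n) * T n 2 - sum_n_m (fun i => g i / INR i ^ 2) 1 n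
  = sum_n_m (fun i => u i * (T i 2 - 1 / INR i)) 1 n.
Proof.
  intros Hu Hg H; induction n as [|n IH].
  - rewrite !sum1_0, Hu, Hg; ring.
  - rewrite !sum1_S, <- IH, (T_S n).
    replace (g n) with (g (S n) - INR (S n) * (u (S n) - u n)) by (rewrite H; ring).
    rewrite (S_INR (S n)); field; apply not_0_INR; lia.
Qed.

Lemma tail_series (u g : nat -> R) (l m B : R) :
  u 0%nat = 0 -> g 0%nat = 0 ->
  (forall k, INR (S k) * (u (S k) - u k) = g (S k) - g k) ->
  (forall k, Rabs (g k) <= B) ->
  is_lim_seq u l ->
  is_lim_seq (sum_n_m (fun i => g i / INR i ^ 2) 1) m ->
  is_series (fun k => u (1 + k)%nat * (T (1 + k) 2 - 1 / INR (1 + k))) (l - m).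
Proof.
  intros Hu Hg H HB Hl Hm.
  apply (is_series_sum1 (fun i => u i * (T i 2 - 1 / INR i))).
  apply is_lim_seq_ext with (1 := fun n => tail_partial_sum u g n Hu Hg H).
  assert (HgT : is_lim_seq (fun n => g n * T n 2) 0).
  { apply is_lim_seq_squeeze0 with (v := fun n => B * T n 2).
    - intros n.
      assert (0 <= T n 2).
      { pose proof (T_lower n).
        pose proof (Rinv_0_lt_compat _ (INR_S_pos n)); lra. }
      rewrite Rabs_mult, (Rabs_pos_eq (T n 2)) by assumption.
      now apply Rmult_le_compat_r.
    - replace (Finite 0) with (Rbar_mult B 0) by (simpl; f_equal; ring).
      exact (is_lim_seq_scal_l _ B (Finite 0) T_lim). }
  replace (l - m) with (l * 1 - 0 - m) by ring.
  apply is_lim_seq_ext with (fun n =>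
    u n * (INR (S n) * T n 2) - g n * T n 2
    - sum_n_m (fun i => g i / INR i ^ 2) 1 n).
  - intros n; ring.
  - apply is_lim_seq_minus'; [apply is_lim_seq_minus'|]; try assumption.
    apply is_lim_seq_mult'; [assumption | apply mul_T_lim].
Qed.

Lemma psum_bounded : exists B, forall n, Rabs (psum (-1) 1 n) <= B.
Proof.
  destruct (maj_by_pos (psum (-1) 1)) as [B [_ HB]]; [|now exists B].
  exists (- ln 2); apply is_lim_seq_Reals, psum_log2.
Qed.

Theorem proposition6p5 :
  is_series (fun k : nat => let n := (1 + k)%nat in
               Hbar n * (T n 2 - 1 / INR n))
            (- ln 2 + 3 / 4 * zeta 2)
  /\
  is_series (fun k : nat => let n := (1 + k)%nat in
               (Hbar n) ^ 2 * (T n 2 - 1 / INR n))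
            (5 / 8 * zeta 3 - 3 / 2 * zeta 2 * ln 2 + (ln 2) ^ 2).
Proof.
  cbv zeta; split.
  - apply is_series_ext with (fun k =>
      psum (-1) 1 (1 + k) * (T (1 + k) 2 - 1 / INR (1 + k))).
    { intros k; now rewrite Hbar_psum. }
    replace (- ln 2 + 3 / 4 * zeta 2) with (- ln 2 - (- (3 / 4) * zeta 2)) by ring.
    (* n times the increment of Hbar is (-1)^n, and g sums these signs. *)
    apply tail_series with (g := fun n => ((-1) ^ n - 1) / 2) (B := 1).
    + apply psum_0.
    + simpl; field.
    + intros k; rewrite psum_S, <- (tech_pow_Rmult (-1) k), pow_1; field; apply not_0_INR; lia.
    + intros k; pose proof (sign_abs (-1) k ltac:(lra)) as E.
      revert E; generalize ((-1) ^ k); intros x; unfold Rabs.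
      repeat destruct Rcase_abs; lra.
    + apply psum_log2.
    + pose proof (psum_zeta 2 ltac:(lia)) as Z.
      replace (INR 2) with 2 in Z by (simpl; ring).
      pose proof (psum_eta 2 _ ltac:(lia) Z) as E.
      pose proof (is_lim_seq_scal_l _ (1 / 2) (Finite _)
        (is_lim_seq_minus' _ _ _ _ E Z)) as K.
      replace (- (3 / 4) * zeta 2)
        with (1 / 2 * ((2 / 2 ^ 2 - 1) * zeta 2 - zeta 2)) by field.
      revert K; apply is_lim_seq_ext; intros n.
      rewrite (sum1_ext _ (fun i => 1 / 2 * ((-1) ^ i / INR i ^ 2)
                              + (- (1 / 2)) * (1 ^ i / INR i ^ 2))).
      * rewrite sum1_plus, !sum1_scal.
        fold (psum (-1) 2 n) (psum 1 2 n); unfold Rminus; ring.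
      * intros i Hi; rewrite pow1; field; apply not_0_INR; lia.
  - apply is_series_ext with (fun k =>
      psum (-1) 1 (1 + k) ^ 2 * (T (1 + k) 2 - 1 / INR (1 + k))).
    { intros k; now rewrite Hbar_psum. }
    replace (5 / 8 * zeta 3 - 3 / 2 * zeta 2 * ln 2 + ln 2 ^ 2)
      with ((- ln 2) * ((- ln 2) * 1)
            - (3 / 2 * zeta 2 * ln 2 - 5 / 8 * zeta 3)) by ring.
    destruct psum_bounded as [B HB].
    (* n (h_n^2 - h_(n-1)^2) = (-1)^n (h_n + h_(n-1)), which telescopes
       because the sign alternates. *)
    apply (tail_series (fun n => psum (-1) 1 n ^ 2)
             (fun n => (-1) ^ n * psum (-1) 1 n) _ _ B).
    + rewrite psum_0; ring.
    + rewrite psum_0; ring.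
    + intros k; rewrite !psum_S.
      rewrite <- (tech_pow_Rmult (-1) k), pow_1.
      assert (HN : INR (S k) <> 0) by (apply not_0_INR; lia).
      generalize ((-1) ^ k) (psum (-1) 1 k); intros x h.
      field; assumption.
    + intros k; rewrite Rabs_mult, sign_abs, Rmult_1_l by lra; apply HB.
    + repeat apply is_lim_seq_mult'; try apply psum_log2.
      apply is_lim_seq_const.
    + apply is_lim_seq_ext with (2 := esum_alternating); intros n.
      apply sum1_ext; intros i Hi; unfold Rdiv; ring.
Qed.
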